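(* Let $n\ge 1$, $s_{\mathcal L}\in\mathbb C^n$, $V_0\ge 0$, $\theta_0\in(-\pi,\pi]$, and let $Z=Y_{\mathcal L\mathcal L}^{-1}\in\mathbb C^{n\times n}$ be the impedance matrix of the grid. Assume that $$V_0^2 > 4\,\|Z\|^*\,\|s_{\mathcal L}\|.$$ Let $v_{\mathcal L}\in\mathbb C^n$ be the unique solution of the power flow equations of the form $$v_{\mathcal L}=V_0e^{j\theta_0}\left(\mathbf 1+\frac{1}{V_0^2}Z\bar s_{\mathcal L}+\frac{1}{V_0^4}Z\lambda\right)\quad\text{with }\lambda\in\mathbb C^n,\ \|\lambda\|\le 4\|Z\|^*\|s_{\mathcal L}\|^2 .$$ Then $v_{\mathcal L}$ is approximated by $$\hat v_{\mathcal L}:=V_0e^{j\theta_0}\left(\mathbf 1+\frac{1}{V_0^2}Z\bar s_{\mathcal L}\right),$$ in the sense that for every $h\in\mathcal L$ the approximation error satisfies $$|v_h-\hat v_h|\le \frac{4}{V_0^3}\,\|Z_{h\bullet}\|\,\|Z\|^*\,\|s_{\mathcal L}\|^2,$$ where $Z_{h\bullet}$ is the $h$-th row of $Z$.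
   Context: Here $j$ is the imaginary unit, a bar denotes entrywise complex conjugation, $\mathbf 1$ is the all-ones vector, and $\operatorname{diag}(x)$ is the diagonal matrix with the entries of the vector $x$ on the diagonal. Grid: the buses are $\{0,1,\dots,n\}$, with $\mathcal L=\{1,\dots,n\}$. The nodal admittance matrix $Y\in\mathbb C^{(n+1)\times(n+1)}$ is the weighted Laplacian of the connected graph describing the grid (complex edge weights equal to the line admittances), so $Y\mathbf 1=0$. The block $Y_{\mathcal L\mathcal L}\in\mathbb C^{n\times n}$, obtained by deleting the row and column of bus $0$, is invertible, and $Z:=Y_{\mathcal L\mathcal L}^{-1}$. Power flow equations: given $V_0$, $\theta_0$, $s_{\mathcal L}$, a vector $v_{\mathcal L}\in\mathbb C^n$ is a solution of the power flow equations if there exists $i_{\mathcal L}\in\mathbb C^n$ such that, with $v_0=V_0e^{j\theta_0}$, $$s_{\mathcal L}=\operatorname{diag}(\bar i_{\mathcal L})\,v_{\mathcal L},\qquad v_{\mathcal L}=v_0\mathbf 1+Z\,i_{\mathcal L}.$$ Under the assumption $V_0^2>4\|Z\|^*\|s_{\mathcal L}\|$, a solution of the form described in the claim exists and is unique. Norms: for $x\in\mathbb C^n$ (column or row), $\|x\|=\sqrt{\sum_h|x_h|^2}$; for $A\in\mathbb C^{n\times n}$, $\|A\|^*=\max_h\|A_{h\bullet}\|=\max_h\sqrt{\sum_k|A_{hk}|^2}$, where $A_{h\bullet}$ is the $h$-th row of $A$. *)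

(* Defs.v *)
From mathcomp Require Import all_boot all_order all_algebra.
From mathcomp Require Import all_classical all_reals all_analysis.
From mathcomp Require Export complex.

Set Implicit Arguments.
Unset Strict Implicit.
Unset Printing Implicit Defensive.

Import Order.TTheory GRing.Theory Num.Theory.
Local Open Scope ring_scope.
Local Open Scope complex_scope.

(* The buses are 'I_n.+1; the values of [admittance] outside [line] are
   irrelevant. *)
Record grid (R : realType) (n : nat) := Grid {
  line : rel 'I_n.+1;
  admittance : 'I_n.+1 -> 'I_n.+1 -> R[i];
  line_sym : symmetric line;
  line_irrefl : irreflexive line;
  line_connected : forall h k, connect line h k;
  admittance_sym : forall h k, line h k -> admittance h k = admittance k h;
  admittance_neq0 : forall h k, line h k -> admittance h k != 0
}.

Section PowerFlow.
Context {R : realType}.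
Implicit Types (n : nat) (t : R).

Definition expj t : R[i] := cos t +i* sin t.

Definition vconj n (x : 'cV[R[i]]_n) : 'cV[R[i]]_n := map_mx conjc x.

Definition ones n : 'cV[R[i]]_n := const_mx 1.

(* [Normc.normc] is the R-valued modulus; the norm `|z| of R[i] is
   R[i]-valued. *)
Definition cnorm n (x : 'cV[R[i]]_n) : R :=
  Num.sqrt (\sum_(h < n) Normc.normc (x h 0) ^+ 2).

Definition rnorm n (x : 'rV[R[i]]_n) : R :=
  Num.sqrt (\sum_(h < n) Normc.normc (x 0 h) ^+ 2).

(* The default value 0 is harmless since row norms are nonnegative. *)
Definition mxnorm_star n (A : 'M[R[i]]_n) : R :=
  \big[Num.max/0]_(h < n) rnorm (row h A).

Definition nodal_admittance n (G : grid R n) : 'M[R[i]]_n.+1 :=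
  \matrix_(h, k)
    if h == k then \sum_(l | line G h l) admittance G h l
    else if line G h k then - admittance G h k else 0.

(* The load buses 1, ..., n are indexed by 'I_n: h stands for bus h.+1. *)
Definition load_admittance n (G : grid R n) : 'M[R[i]]_n :=
  row' ord0 (col' ord0 (nodal_admittance G)).

Definition impedance n (G : grid R n) : 'M[R[i]]_n :=
  invmx (load_admittance G).

Definition slack_voltage (V0 t0 : R) : R[i] := V0%:C * expj t0.

Definition power_flow_solution n (Z : 'M[R[i]]_n) (V0 t0 : R)
    (s v : 'cV[R[i]]_n) : Prop :=
  exists i : 'cV[R[i]]_n,
    s = diag_mx ((vconj i)^T) *m v /\
    v = slack_voltage V0 t0 *: ones n + Z *m i.

Definition approx_solution n (Z : 'M[R[i]]_n) (V0 t0 : R)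
    (s : 'cV[R[i]]_n) : 'cV[R[i]]_n :=
  slack_voltage V0 t0 *:
    (ones n + (1 / V0 ^+ 2)%:C *: (Z *m vconj s)).

Definition has_expansion n (Z : 'M[R[i]]_n) (V0 t0 : R)
    (s v : 'cV[R[i]]_n) : Prop :=
  exists lambda : 'cV[R[i]]_n,
    cnorm lambda <= 4 * mxnorm_star Z * cnorm s ^+ 2 /\
    v = slack_voltage V0 t0 *:
      (ones n + (1 / V0 ^+ 2)%:C *: (Z *m vconj s)
              + (1 / V0 ^+ 4)%:C *: (Z *m lambda)).

End PowerFlow.

(* Main.v *)
Require Import Defs.
From mathcomp Require Import all_boot all_order all_algebra.
From mathcomp Require Import all_classical all_reals all_analysis.
From mathcomp Require Import ring lra.
Import Order.TTheory GRing.Theory Num.Theory.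
Local Open Scope ring_scope.
Local Open Scope complex_scope.

(* Write [v = v0 (1 + w)] with [v0 = V0 e^(j theta0)] and [b = V0^2].
   Eliminating the currents turns the power flow equations into the fixed
   point equation [w = b^-1 Z (conj s / (1 + conj w))].  By Cauchy-Schwarz
   the right-hand side maps the sup-norm ball of radius 1/2 to itself and is
   [4 |Z|* |s| / b]-Lipschitz there, hence a contraction.  Its fixed point
   satisfies [|w_h| <= 2 |Z|* |s| / b], which gives the bound on [lambda];
   conversely that bound puts the [w] of any expansion in the ball.  The error
   estimate is Cauchy-Schwarz applied to [Z lambda]. *)

Local Notation normc := Normc.normc.

(** * The real-valued modulus on the complex numbers *)

Section Modulus.
Context {R : realType}.
Implicit Types (x y z : R[i]) (t : R).

Lemma normc_ge0 x : 0 <= normc x.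
Proof. by case: x => a b; exact: sqrtr_ge0. Qed.

Lemma ler_normcD x y : normc (x + y) <= normc x + normc y.
Proof. exact: le_normcD. Qed.

Lemma normc_opp x : normc (- x) = normc x.
Proof. exact: normcN. Qed.

Lemma normc_distC x y : normc (x - y) = normc (y - x).
Proof. by rewrite -normc_opp opprB. Qed.

Lemma ler_normc_dist x y z : normc (x - z) <= normc (x - y) + normc (y - z).
Proof. by rewrite -[x - z](subrKA y) ler_normcD. Qed.

Lemma normc_conj x : normc x^*%C = normc x.
Proof. by case: x => a b; rewrite /normc /= sqrrN. Qed.

Lemma normc_real t : normc t%:C = `|t|.
Proof. by rewrite /normc /= expr0n addr0 sqrtr_sqr. Qed.

Lemma normc_expj t : normc (expj t) = 1.
Proof. by rewrite /normc /= cos2Dsin2 sqrtr1. Qed.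

Lemma normc_le_Re_Im x : normc x <= `|complex.Re x| + `|complex.Im x|.
Proof.
case: x => a b; rewrite /normc /= -[leRHS]ger0_norm ?addr_ge0//.
rewrite -sqrtr_sqr ler_sqrt ?sqr_ge0// sqrrD !real_normK ?num_real//.
by have := mulr_ge0 (normr_ge0 a) (normr_ge0 b); lra.
Qed.

Lemma norm_Re_le x : `|complex.Re x| <= normc x.
Proof.
case: x => a b; rewrite /normc /= -sqrtr_sqr ler_sqrt ?addr_ge0 ?sqr_ge0//.
by rewrite lerDl sqr_ge0.
Qed.

Lemma norm_Im_le x : `|complex.Im x| <= normc x.
Proof.
case: x => a b; rewrite /normc /= -sqrtr_sqr ler_sqrt ?addr_ge0 ?sqr_ge0//.
by rewrite lerDr sqr_ge0.
Qed.

Lemma normc_sum n (F : 'I_n -> R[i]) :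
  normc (\sum_i F i) <= \sum_i normc (F i).
Proof.
elim/big_ind2: _ => [|x1 x2 y1 y2 h1 h2|//]; first by rewrite Normc.normc0.
by rewrite (le_trans (ler_normcD _ _))// lerD.
Qed.

Lemma normc_add1_ge x : normc x <= 2^-1 -> 2^-1 <= normc (1 + x).
Proof.
move=> hx; have := ler_normcD (1 + x) (- x).
by rewrite addrK normc_opp Normc.normc1; lra.
Qed.

End Modulus.

(** * Sequences with geometrically decaying increments *)

Section Geometric.
Import numFieldNormedType.Exports.
Context {R : realType}.
Implicit Types q : R.

(** Let [k] tend to infinity. Later limit arguments take this form: an estimate is proved up to an
    error [K * q ^+ k] for every [k]. *)
Lemma le_geometric_le0 q K t :
  0 <= q < 1 -> (forall k, t <= K * q ^+ k) -> t <= 0.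
Proof.
move=> /andP[q0 q1] h.
have c : ((fun k => K * q ^+ k) @ \oo --> (0 : R))%classic.
  rewrite -[X in (_ --> X)%classic](mulr0 K); apply: cvgMr.
  by apply: cvg_expr; rewrite ger0_norm.
rewrite -(cvg_lim _ c)//; apply: limr_ge; first by apply/cvg_ex; exists 0.
by apply: nearW.
Qed.

Lemma real_geometric_limit q C (u : nat -> R) : 0 <= q < 1 ->
  (forall k, `|u k.+1 - u k| <= C * q ^+ k) ->
  exists l, forall k, `|u k - l| <= C / (1 - q) * q ^+ k.
Proof.
(* [u k - D q^k] increases and [u k + D q^k] decreases, so the supremum of the
   former is the limit, with the announced error bound. *)
move=> /andP[q0 q1] hu; set D := C / (1 - q).
(* [D * q ^+ k] is the tail from [k] of the series of increment bounds, so each bound is a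
   difference of consecutive tails and telescopes. *)
have DE k : C * q ^+ k = D * q ^+ k - D * q ^+ k.+1.
  by rewrite exprS /D; field; rewrite subr_eq0 gt_eqF.
have lo j k : u k - D * q ^+ k <= u (k + j)%N - D * q ^+ (k + j).
  elim: j => [|j ih]; first by rewrite addn0.
  rewrite addnS (le_trans ih)//; move: (hu (k + j)%N); rewrite DE ler_norml.
  lra.
have up j k : u (k + j)%N + D * q ^+ (k + j) <= u k + D * q ^+ k.
  elim: j => [|j ih]; first by rewrite addn0.
  rewrite addnS (le_trans _ ih)//; move: (hu (k + j)%N); rewrite DE ler_norml.
  lra.
have D0 k : 0 <= D * q ^+ k.
  rewrite mulr_ge0 ?exprn_ge0// divr_ge0 ?subr_ge0 ?(ltW q1)//.
  by have := le_trans (normr_ge0 _) (hu 0%N); rewrite mulr1.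
have cross j k : u j - D * q ^+ j <= u k + D * q ^+ k.
  have [jk|/ltnW kj] := leqP j k.
    by have := lo (k - j)%N j; rewrite subnKC//; move: (D0 k); lra.
  by have := up (j - k)%N k; rewrite subnKC//; move: (D0 j); lra.
pose E := range (fun k => u k - D * q ^+ k).
have E0 : (E !=set0)%classic by exists (u 0%N - D * q ^+ 0); exists 0%N.
have Eub k : ubound E (u k + D * q ^+ k) by move=> _ [j _ <-].
exists (sup E) => k; rewrite ler_distlC.
rewrite (ge_sup E0 (Eub k)) andbT.
by apply: ub_le_sup; [exists (u k + D * q ^+ k) | exists k].
Qed.

(** Real and imaginary parts converge separately; adding their two errors produces the factor 2. *)
Lemma complex_geometric_limit q C (u : nat -> R[i]) : 0 <= q < 1 ->
  (forall k, normc (u k.+1 - u k) <= C * q ^+ k) ->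
  exists l, forall k, normc (u k - l) <= 2 * C / (1 - q) * q ^+ k.
Proof.
move=> q01 hu.
have [k|a ha] := @real_geometric_limit q C (fun k => complex.Re (u k)) q01.
  by rewrite -raddfB; exact: le_trans (norm_Re_le _) (hu k).
have [k|b hb] := @real_geometric_limit q C (fun k => complex.Im (u k)) q01.
  by rewrite -raddfB; exact: le_trans (norm_Im_le _) (hu k).
exists (a +i* b) => k; apply: le_trans (normc_le_Re_Im _) _.
have := ha k; have := hb k; case: (u k) => x y /=; lra.
Qed.

End Geometric.

(** * Fixed points of sup-norm contractions on a ball *)

Section Contraction.
Context {R : realType} {n : nat}.
Variables (F : 'cV[R[i]]_n -> 'cV[R[i]]_n) (r q : R).
Hypothesis q01 : 0 <= q < 1.

(** Sup-norm bounds are stated entry by entry, so that no maximum has to be formed. *)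
Definition in_ball (x : 'cV[R[i]]_n) := forall h, normc (x h 0) <= r.
Definition sup_dist_le (x y : 'cV[R[i]]_n) (e : R) :=
  forall h, normc (x h 0 - y h 0) <= e.

Hypothesis F_contr : forall x y e, in_ball x -> in_ball y ->
  sup_dist_le x y e -> sup_dist_le (F x) (F y) (q * e).

Lemma sup_contraction_unique x y :
  in_ball x -> in_ball y -> F x = x -> F y = y -> x = y.
Proof.
move=> bx by_ Fx Fy.
(* Two points of the ball are at most [2 * r] apart, and each application of [F] gains a factor [q]
   while fixing both points. *)
have d k : sup_dist_le x y (2 * r * q ^+ k).
  elim: k => [|k ih] h.
    rewrite mulr1 (le_trans (ler_normcD _ _))// normc_opp.
    by have := bx h; have := by_ h; lra.
  by rewrite exprS mulrCA -Fx -Fy; exact: F_contr.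
apply/matrixP => h j; rewrite ord1; apply/eqP; rewrite -subr_eq0; apply/eqP.
apply: Normc.eq0_normc; apply/le_anti; rewrite normc_ge0 andbT.
by apply: (le_geometric_le0 _ (2 * r) _ q01) => k; exact: d.
Qed.

Hypothesis r_ge0 : 0 <= r.
Hypothesis F_ball : forall x, in_ball x -> in_ball (F x).

(** Banach iteration started at 0, the limit being taken in each entry separately. *)
Lemma sup_contraction_fixpoint : exists2 x, in_ball x & F x = x.
Proof.
pose u k := iter k F 0.
have bu k : in_ball (u k).
  elim: k => [h|k ih]; first by rewrite mxE Normc.normc0.
  exact: F_ball.
have du k : sup_dist_le (u k.+1) (u k) (2 * r * q ^+ k).
  elim: k => [|k ih].
    move=> h; rewrite mulr1 (le_trans (ler_normcD _ _))// normc_opp.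
    by rewrite mulr_natl mulr2n; exact: lerD (bu 1%N h) (bu 0%N h).
  by rewrite exprS mulrCA; exact: F_contr _ _ _ (bu k.+1) (bu k) ih.
(* The constant of [complex_geometric_limit] for increments bounded by [2 * r * q ^+ k]. *)
pose K := 2 * (2 * r) / (1 - q).
have /choice[l hl] h := complex_geometric_limit _ _ (fun k => u k h 0) q01
  (fun k => du k h).
pose x : 'cV[R[i]]_n := \col_h l h.
have dx k : sup_dist_le (u k) x (K * q ^+ k).
  by move=> h; rewrite mxE; exact: hl.
have bx : in_ball x.
  move=> h; rewrite -subr_le0.
  apply: (le_geometric_le0 _ K _ q01) => k.
  have := ler_normcD (x h 0 - u k h 0) (u k h 0); rewrite subrK normc_distC.
  by have := bu k h; have := dx k h; lra.
exists x => //.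
apply/matrixP => h j; rewrite ord1; apply/eqP; rewrite -subr_eq0; apply/eqP.
apply: Normc.eq0_normc; apply/le_anti; rewrite normc_ge0 andbT.
(* [F x] and [x] are both compared with [u k.+1]: contraction and convergence each contribute
   [K * q ^+ k.+1]. *)
apply: (le_geometric_le0 _ (2 * q * K) _ q01) => k.
apply: le_trans (ler_normc_dist _ (u k.+1 h 0) _) _.
have := F_contr _ _ _ (bu k) bx (dx k) h; rewrite normc_distC -/(u k.+1).
by have := dx k.+1 h; rewrite exprS; lra.
Qed.

End Contraction.

(** * Cauchy-Schwarz and matrix-vector bounds *)

Section Norms.
Context {R : realType}.

(** Lagrange's identity writes twice the gap between the squared sides as a double sum of
    squares. *)
Lemma cauchy_schwarz n (a b : 'I_n -> R) :
  \sum_i a i * b i <=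
  Num.sqrt (\sum_i a i ^+ 2) * Num.sqrt (\sum_i b i ^+ 2).
Proof.
have sq0 (c : 'I_n -> R) : 0 <= \sum_i c i ^+ 2.
  by apply: sumr_ge0 => i _; exact: sqr_ge0.
rewrite -sqrtrM//; apply: (le_trans (ler_norm _)).
rewrite -sqrtr_sqr ler_sqrt ?mulr_ge0//.
have lagrange : 0 <= \sum_i \sum_j (a i * b j - a j * b i) ^+ 2.
  by do 2 ![apply: sumr_ge0 => ? _]; exact: sqr_ge0.
have E (c d : 'I_n -> R) :
    (\sum_i c i) * (\sum_i d i) = \sum_i \sum_j c i * d j.
  by rewrite mulr_suml; apply: eq_bigr => i _; rewrite mulr_sumr.
suff: \sum_i \sum_j (a i * b j - a j * b i) ^+ 2 =
      2 * ((\sum_i a i ^+ 2) * (\sum_i b i ^+ 2) - (\sum_i a i * b i) ^+ 2).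
  by move=> e; move: lagrange; rewrite e pmulr_rge0// subr_ge0.
(* One of the two copies of the product is commuted, so that the double sums agree term by term. *)
rewrite mulrBr mulr2n mulrDl mul1r {2}(mulrC (\sum_i a i ^+ 2)) expr2 !E.
rewrite mulr_sumr -big_split -sumrB; apply: eq_bigr => i _.
rewrite mulr_sumr -big_split -sumrB; apply: eq_bigr => j _ /=.
by ring.
Qed.

Lemma rnorm_ge0 n (x : 'rV[R[i]]_n) : 0 <= rnorm x.
Proof. exact: sqrtr_ge0. Qed.

Lemma cnorm_ge0 n (x : 'cV[R[i]]_n) : 0 <= cnorm x.
Proof. exact: sqrtr_ge0. Qed.

Lemma mxnorm_star_ge0 n (A : 'M[R[i]]_n) : 0 <= mxnorm_star A.
Proof. by rewrite /mxnorm_star; apply: bigmax_ge_id. Qed.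

Lemma rnorm_row_le n (A : 'M[R[i]]_n) h : rnorm (row h A) <= mxnorm_star A.
Proof. exact: (le_bigmax _ (fun h => rnorm (row h A))). Qed.

Lemma normc_mulmx_row n (A : 'M[R[i]]_n) (x : 'cV_n) h :
  normc ((A *m x) h 0) <= rnorm (row h A) * cnorm x.
Proof.
rewrite mxE (le_trans (normc_sum _ _))//.
under eq_bigr do rewrite Normc.normcM.
rewrite (le_trans (cauchy_schwarz _ (fun k => normc (A h k))
  (fun k => normc (x k 0))))//.
by rewrite /rnorm; under [X in _ <= Num.sqrt X * _]eq_bigr do rewrite mxE.
Qed.

Lemma normc_mulmx n (A : 'M[R[i]]_n) (x : 'cV_n) h :
  normc ((A *m x) h 0) <= mxnorm_star A * cnorm x.
Proof.
apply: le_trans (normc_mulmx_row _ _ _ _) _.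
by rewrite ler_wpM2r ?cnorm_ge0// rnorm_row_le.
Qed.

Lemma cnorm_le n (x y : 'cV[R[i]]_n) c : 0 <= c ->
  (forall h, normc (x h 0) <= c * normc (y h 0)) -> cnorm x <= c * cnorm y.
Proof.
move=> c0 xy; rewrite /cnorm -[X in X * _](ger0_norm c0) -sqrtr_sqr.
rewrite -sqrtrM ?sqr_ge0// ler_wsqrtr// mulr_sumr ler_sum// => h _.
by rewrite -exprMn lerXn2r ?nnegrE ?mulr_ge0 ?normc_ge0.
Qed.

Lemma cnorm_conj n (x : 'cV[R[i]]_n) : cnorm (vconj x) = cnorm x.
Proof.
by rewrite /cnorm; under eq_bigr do rewrite mxE normc_conj.
Qed.

End Norms.

(** * The power flow map as a contraction; [b] stands for the squared slack voltage magnitude *)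

Section PowerFlow.
Context {R : realType} {n : nat}.
Variables (Z : 'M[R[i]]_n) (s : 'cV[R[i]]_n) (b : R).
Local Notation a := (mxnorm_star Z).
Local Notation sigma := (cnorm s).
Implicit Types w : 'cV[R[i]]_n.

(** For [v = v0 (1 + w)] the load current is the conjugate of [s_h / v_h]; this is that current
    divided by [v0 / b]. *)
Definition scaled_current w : 'cV[R[i]]_n :=
  \col_h ((s h 0)^*%C / (1 + (w h 0)^*%C)).

Definition power_flow_map w : 'cV[R[i]]_n :=
  (1 / b)%:C *: (Z *m scaled_current w).

Hypothesis hb : 4 * a * sigma < b.

Let as_ge0 : 0 <= a * sigma.
Proof. by rewrite mulr_ge0 ?mxnorm_star_ge0 ?cnorm_ge0. Qed.

Let b_gt0 : 0 < b.
Proof. by apply: le_lt_trans hb; rewrite -mulrA mulr_ge0. Qed.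

Let q := 4 * a * sigma / b.

Lemma power_flow_ratio : 0 <= q < 1.
Proof.
rewrite /q ltr_pdivrMr// mul1r hb andbT.
by rewrite divr_ge0 ?(ltW b_gt0)// -mulrA mulr_ge0.
Qed.

Lemma conj_add1_ge x :
  normc x <= 2^-1 -> 2^-1 <= normc (1 + x^*%C : R[i]).
Proof. by move=> hx; apply: normc_add1_ge; rewrite normc_conj. Qed.

Lemma normc_gt0_neq0 (x : R[i]) : 0 < normc x -> x != 0.
Proof. by apply: contraTneq => ->; rewrite Normc.normc0 ltxx. Qed.

Lemma conj_add1_neq0 (x : R[i]) : normc x <= 2^-1 -> 1 + x^*%C != 0.
Proof.
by move=> /conj_add1_ge hx; apply: normc_gt0_neq0; apply: lt_le_trans hx.
Qed.

(** Radius 1/2 keeps the denominator of the scaled current at distance at least 1/2 from 0. *)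
Lemma conj_add1_inv (x : R[i]) :
  normc x <= 2^-1 -> normc (1 + x^*%C)^-1 <= 2.
Proof.
move=> /conj_add1_ge hx; rewrite Normc.normcV -[leRHS]invrK.
by rewrite lef_pV2// posrE// (lt_le_trans _ hx).
Qed.

Lemma cnorm_scaled_current w :
  in_ball 2^-1 w -> cnorm (scaled_current w) <= 2 * sigma.
Proof.
move=> hw; apply: cnorm_le => // h.
rewrite mxE Normc.normcM normc_conj mulrC ler_wpM2r ?normc_ge0//.
exact: conj_add1_inv.
Qed.

(** Sharper than the ball radius: at a fixed point, this is the bound on [w] from which the estimate
    of [lambda] follows. *)
Lemma power_flow_map_le w h :
  in_ball 2^-1 w -> normc (power_flow_map w h 0) <= q / 2.
Proof.
move=> hw; rewrite mxE Normc.normcM normc_real ger0_norm; last first.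
  by rewrite divr_ge0 // ltW.
have -> : q / 2 = 1 / b * (a * (2 * sigma)).
  by rewrite /q; field; rewrite gt_eqF.
rewrite ler_wpM2l ?divr_ge0 ?(ltW b_gt0)//.
apply: le_trans (normc_mulmx _ _ _ _) _.
by rewrite ler_wpM2l ?mxnorm_star_ge0// cnorm_scaled_current.
Qed.

Lemma power_flow_map_ball w : in_ball 2^-1 w -> in_ball 2^-1 (power_flow_map w).
Proof.
move=> hw h; apply: le_trans (power_flow_map_le _ _ hw) _.
by have := power_flow_ratio; lra.
Qed.

Lemma power_flow_map_contr w1 w2 e : in_ball 2^-1 w1 -> in_ball 2^-1 w2 ->
  sup_dist_le w1 w2 e ->
  sup_dist_le (power_flow_map w1) (power_flow_map w2) (q * e).
Proof.
move=> h1 h2 h12 h.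
have e0 : 0 <= e := le_trans (normc_ge0 _) (h12 h).
have d : cnorm (scaled_current w1 - scaled_current w2) <= 4 * e * sigma.
  apply: cnorm_le => [|k]; first exact: mulr_ge0.
  (* A difference of inverses is the difference of the denominators times both inverses; each
     inverse is at most 2, whence the constant 4. *)
  have -> : (scaled_current w1 - scaled_current w2) k 0 =
      (1 + (w1 k 0)^*%C)^-1 * (1 + (w2 k 0)^*%C)^-1 *
      (w2 k 0 - w1 k 0)^*%C * (s k 0)^*%C.
    rewrite !mxE rmorphB; field.
    by rewrite !conj_add1_neq0.
  rewrite 3!Normc.normcM !normc_conj ler_wpM2r ?normc_ge0//.
  apply: ler_pM; rewrite ?mulr_ge0 ?normc_ge0//; last by rewrite normc_distC.
  by rewrite [leRHS](_ : 4 = 2 * 2) ?ler_pM ?normc_ge0 ?conj_add1_inv//; ring.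
have -> : power_flow_map w1 h 0 - power_flow_map w2 h 0 =
    (1 / b)%:C * (Z *m (scaled_current w1 - scaled_current w2)) h 0.
  by rewrite mulmxBr !mxE mulrBr.
rewrite Normc.normcM normc_real ger0_norm; last by rewrite divr_ge0// ltW.
have -> : q * e = 1 / b * (a * (4 * e * sigma)).
  by rewrite /q; field; rewrite gt_eqF.
rewrite ler_wpM2l ?divr_ge0 ?(ltW b_gt0)//.
apply: le_trans (normc_mulmx _ _ _ _) _.
by rewrite ler_wpM2l ?mxnorm_star_ge0.
Qed.

End PowerFlow.

(** * Correspondence between fixed points and power flow solutions *)

Section Solutions.
Context {R : realType} {n : nat}.
Variables (Z : 'M[R[i]]_n) (s : 'cV[R[i]]_n) (V0 t0 : R).
Hypothesis hV0 : 0 <= V0.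
Hypothesis hs : 4 * mxnorm_star Z * cnorm s < V0 ^+ 2.
Local Notation v0 := (slack_voltage V0 t0).
Local Notation b := (V0 ^+ 2).
Implicit Types w v : 'cV[R[i]]_n.

Lemma slack_magnitude_gt0 : 0 < V0.
Proof.
have : 0 < V0 ^+ 2.
  by apply: le_lt_trans hs; rewrite !mulr_ge0 ?mxnorm_star_ge0 ?cnorm_ge0.
by rewrite exprn_even_gt0//= lt0r hV0 => ->.
Qed.

Lemma normc_slack : normc v0 = V0.
Proof. by rewrite Normc.normcM normc_expj mulr1 normc_real ger0_norm. Qed.

Lemma slack_conj : v0^*%C * v0 = b%:C.
Proof.
apply/eqP; rewrite eq_complex /slack_voltage /expj /=.
have := cos2Dsin2 t0; set c := cos t0; set d := sin t0 => cd.
apply/andP; split; apply/eqP; last by ring.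
by rewrite -[RHS]mulr1 -cd; ring.
Qed.

(** With [x] an entry of the scaled current and [y] of [w], this is the power at one load: the
    conjugate of [v0] times [v0] equals [b] and cancels [1 / b]. *)
Lemma load_power (x y : R[i]) :
  (v0 * (1 / b)%:C * x)^*%C * (v0 * (1 + y)) = x^*%C * (1 + y).
Proof.
have bV : b%:C * (1 / b)%:C = 1 :> R[i].
  by rewrite -rmorphM /= mul1r divff// sqrf_eq0 gt_eqF ?slack_magnitude_gt0.
have := slack_conj; move: bV (conjc_real (1 / b)).
move: (1 / b)%:C (v0) => c u uc cc uu.
rewrite 2!rmorphM /= cc -[RHS]mul1r -[X in _ = X * _]uc -uu.
by ring.
Qed.

Lemma voltage_solution w : in_ball 2^-1 w ->
  power_flow_map Z s b w = w ->
  power_flow_solution Z V0 t0 s (v0 *: (ones n + w)).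
Proof.
move=> hw fw.
exists ((v0 * (1 / b)%:C) *: scaled_current s w); split; last first.
  by rewrite -{1}fw /power_flow_map scalerDr scalerA -scalemxAr.
apply/matrixP => h j; rewrite ord1 mul_diag_mx !mxE.
rewrite load_power rmorphM fmorphV rmorphD rmorph1 /= !conjcK divfK//.
by rewrite -conjc_eq0 rmorphD rmorph1 /=; exact: (conj_add1_neq0 _ (hw h)).
Qed.

Lemma voltage_expansion w : in_ball 2^-1 w ->
  power_flow_map Z s b w = w ->
  has_expansion Z V0 t0 s (v0 *: (ones n + w)).
Proof.
move=> hw fw; have V0_gt0 := slack_magnitude_gt0.
have b_gt0 : 0 < b by rewrite exprn_gt0.
(* Forced by comparing the expansion with [w = (1 / b) Z (scaled_current s w)]. *)
exists (b%:C *: (scaled_current s w - vconj s)); split.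
  rewrite expr2 mulrA; apply: cnorm_le => [|h].
    by rewrite !mulr_ge0 ?mxnorm_star_ge0 ?cnorm_ge0.
  have wh := power_flow_map_le Z s b hs w h hw; rewrite fw in wh.
  have -> : (b%:C *: (scaled_current s w - vconj s)) h 0 =
      b%:C * (- (w h 0)^*%C) * (1 + (w h 0)^*%C)^-1 * (s h 0)^*%C.
    rewrite !mxE; field.
    exact: conj_add1_neq0 _ (hw h).
  rewrite !Normc.normcM normc_opp !normc_conj ler_wpM2r ?normc_ge0//.
  rewrite normc_real ger0_norm ?(ltW b_gt0)//.
  (* The three factors bound, in order, [b], the entry of [w], and the inverse of [1 + conj w]. *)
  rewrite (_ : 4 * mxnorm_star Z * cnorm s =
    b * (4 * mxnorm_star Z * cnorm s / b / 2) * 2); last first.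
    by field; rewrite gt_eqF.
  apply: ler_pM; rewrite ?mulr_ge0 ?normc_ge0 ?(ltW b_gt0)//.
    by rewrite ler_wpM2l ?(ltW b_gt0).
  exact: conj_add1_inv _ (hw h).
congr (_ *: _); rewrite -addrA; congr (_ + _).
rewrite -[LHS]fw /power_flow_map -scalemxAr scalerA -rmorphM /=.
rewrite (_ : 1 / V0 ^+ 4 * b = 1 / b); last by field; rewrite gt_eqF.
by rewrite -scalerDr -mulmxDr addrC subrK.
Qed.

Hypothesis hZ : Z \in unitmx.

(* [Z] is injective, so the current of the power flow equations is the one
   read off the expansion. *)
Lemma solution_fixpoint v :
  power_flow_solution Z V0 t0 s v -> has_expansion Z V0 t0 s v ->
  exists w, [/\ in_ball 2^-1 w, power_flow_map Z s b w = w &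
    v = v0 *: (ones n + w)].
Proof.
move=> [i [si vi]] [l [hl vl]]; have V0_gt0 := slack_magnitude_gt0.
have b_gt0 : 0 < b by rewrite exprn_gt0.
(* The scaled current as read off the expansion; the final steps identify it with
   [scaled_current s w]. *)
pose f := vconj s + (1 / b)%:C *: l : 'cV[R[i]]_n.
pose w := (1 / b)%:C *: (Z *m f).
have vw : v = v0 *: (ones n + w).
  rewrite vl /w /f mulmxDr -scalemxAr -addrA; congr (_ *: (_ + _)).
  rewrite scalerDr scalerA -rmorphM /=; congr (_ + _%:C *: _).
  by field; rewrite gt_eqF.
have a0 := mxnorm_star_ge0 _ Z; have s0 := cnorm_ge0 _ s.
have hs' := hs.
set a := mxnorm_star Z in hs' hl a0; set sigma := cnorm s in hs' hl s0.
(* Both [Z (conj s)] and [(1 / b) Z l] have entries at most [a * sigma], the latter because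
   [4 * a * sigma < b]; their sum is then below [b / 2]. *)
have bw : in_ball 2^-1 w.
  move=> h; rewrite mxE Normc.normcM normc_real ger0_norm; last first.
    by rewrite divr_ge0// ltW.
  rewrite mul1r mulrC ler_pdivrMr//.
  have zs := normc_mulmx _ Z (vconj s) h; rewrite cnorm_conj in zs.
  have zl : normc (((1 / b)%:C *: (Z *m l)) h 0) <= a * sigma.
    rewrite mxE Normc.normcM normc_real ger0_norm; last first.
      by rewrite divr_ge0// ltW.
    rewrite mul1r mulrC ler_pdivrMr//.
    apply: le_trans (normc_mulmx _ _ _ _) _; rewrite -mulrA ler_wpM2l//.
    apply: le_trans hl _; rewrite expr2 mulrA [leRHS]mulrC ler_wpM2r//.
    exact: ltW.
  rewrite /f mulmxDr -scalemxAr mxE.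
  apply: le_trans (ler_normcD _ _) _; apply: le_trans (lerD zs zl) _.
  by rewrite -/a -/sigma; move: hs'; lra.
have ei : i = (v0 * (1 / b)%:C) *: f.
  rewrite -[LHS](mulKmx hZ) -[RHS](mulKmx hZ); congr (_ *m _).
  apply: (addrI (v0 *: ones n)); rewrite -vi vw scalerDr /w -scalemxAr.
  by rewrite scalerA.
exists w; split; [exact: bw | | exact: vw].
rewrite /power_flow_map; congr (_ *: (_ *m _)).
apply/matrixP => h j; rewrite ord1 mxE.
have w1 := conj_add1_neq0 _ (bw h).
apply: (mulIf w1); rewrite mulfVK//.
(* The power equation at [h] becomes [s_h = conj f_h (1 + w_h)]; its conjugate is the required
   identity. *)
move/matrixP/(_ h 0) : si; rewrite mul_diag_mx ei vw.
(* Forgetting the bodies of [f] and [w] makes [mxE] stop at their entries. *)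
move: f w {vw bw ei} w1 => f w w1; rewrite !mxE load_power => ->.
by rewrite rmorphM rmorphD rmorph1 /= conjcK.
Qed.

Lemma expansion_error v h : has_expansion Z V0 t0 s v ->
  normc (v h 0 - approx_solution Z V0 t0 s h 0) <=
  4 / V0 ^+ 3 * rnorm (row h Z) * mxnorm_star Z * cnorm s ^+ 2.
Proof.
move=> [l [hl ->]]; have V0_gt0 := slack_magnitude_gt0.
rewrite /approx_solution -addrA.
rewrite (_ : _ - _ = v0 * (1 / V0 ^+ 4)%:C * (Z *m l) h 0); last first.
  by rewrite !mxE; ring.
rewrite 2!Normc.normcM normc_slack normc_real ger0_norm; last first.
  by rewrite divr_ge0// exprn_ge0.
(* The modulus [V0] of the slack voltage lowers the power of [V0] from 4 to 3. *)
have -> : 4 / V0 ^+ 3 * rnorm (row h Z) * mxnorm_star Z * cnorm s ^+ 2 =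
    V0 * (1 / V0 ^+ 4) * (rnorm (row h Z) * (4 * mxnorm_star Z * cnorm s ^+ 2)).
  by field; rewrite gt_eqF.
rewrite ler_wpM2l ?mulr_ge0 ?invr_ge0 ?exprn_ge0//.
apply: le_trans (normc_mulmx_row _ _ _ _) _.
by rewrite ler_wpM2l ?rnorm_ge0.
Qed.

End Solutions.

Theorem corollary2 (R : realType) (n : nat) (hn : (1 <= n)%N)
    (G : grid R n) (hY : load_admittance G \in unitmx)
    (s : 'cV[R[i]]_n) (V0 theta0 : R)
    (hV0 : 0 <= V0) (htheta0 : - pi < theta0 <= pi)
    (hs : V0 ^+ 2 > 4 * mxnorm_star (impedance G) * cnorm s) :
  exists v : 'cV[R[i]]_n,
    unique (fun w => power_flow_solution (impedance G) V0 theta0 s w /\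
                     has_expansion (impedance G) V0 theta0 s w) v /\
    forall h : 'I_n,
      Normc.normc (v h 0 - approx_solution (impedance G) V0 theta0 s h 0) <=
      4 / V0 ^+ 3 * rnorm (row h (impedance G)) * mxnorm_star (impedance G)
        * cnorm s ^+ 2.
Proof.
have hZ : impedance G \in unitmx by rewrite unitmx_inv.
move: (impedance G) => Z in hs hZ *.
have contr := power_flow_map_contr Z s _ hs.
have q01 := power_flow_ratio Z s _ hs.
have [||w bw fw] := sup_contraction_fixpoint _ 2^-1 _ q01 contr.
- by rewrite invr_ge0.
- exact: power_flow_map_ball.
have ve := voltage_expansion Z s V0 theta0 hV0 hs w bw fw.
exists (slack_voltage V0 theta0 *: (ones n + w)); split; last first.
  by move=> h; exact: expansion_error.
split=> [|v [pv ev]]; first by split=> //; exact: voltage_solution.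
(* A competing solution also comes from a fixed point in the ball, where the contraction has only
   one. *)
have [w' [bw' fw' ->]] := solution_fixpoint Z s V0 theta0 hV0 hs hZ v pv ev.
by rewrite (sup_contraction_unique _ _ _ q01 contr w w').
Qed.
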